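(* Let $m\ge 1$ be an even integer. Then the quaternary cyclic codes $\mathcal{C}_{(0,m)}$ and $\mathcal{C}_{(1,m)}$ are both LCD codes, i.e. $\mathcal{C}_{(e,m)}\cap \mathcal{C}_{(e,m)}^{\perp}=\{0\}$ for each $e\in\{0,1\}$.
   Context: Let $n=4^m-1$. For an integer $0\le i\le 4^m-1$ with base-$4$ expansion $i=\sum_{j=0}^{m-1} i_j4^j$, $i_j\in\{0,1,2,3\}$, the $4$-weight is $w_4(i)=\sum_{j=0}^{m-1} i_j$ (sum in $\mathbb{Z}$). For $e\in\{0,1\}$ put $T_{(e,m)}=\{1\le i\le n-1 : w_4(i)\equiv e \pmod 2\}$. Fix a generator $\alpha$ of $\mathbb{F}_{4^m}^*$. The code $\mathcal{C}_{(e,m)}$ is the cyclic code of length $n$ over $\mathbb{F}_4$ (ideal of $\mathbb{F}_4[x]/(x^n-1)$, identified with a subspace of $\mathbb{F}_4^n$ via coefficients) with generator polynomial $g_{(e,m)}(x)=\prod_{j\in T_{(e,m)}}(x-\alpha^j)\in\mathbb{F}_4[x]$. The dual $\mathcal{C}^\perp$ is taken with respect to the Euclidean inner product $\boldsymbol{x}\cdot\boldsymbol{c}=\sum_i x_ic_i$ on $\mathbb{F}_4^n$. *)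

(* Defs.v *)
From HB Require Import structures.
From mathcomp Require Import all_boot all_order all_algebra all_fingroup.
From mathcomp Require Import all_solvable all_field zify.

Set Implicit Arguments.
Unset Strict Implicit.
Unset Printing Implicit Defensive.

Import GRing.Theory.
Local Open Scope ring_scope.

Definition codelen (m : nat) : nat := (4 ^ m - 1)%N.

Definition w4 (m i : nat) : nat := (\sum_(j < m) (i %/ 4 ^ j) %% 4)%N.

Definition Tset (e m : nat) : seq nat :=
  [seq j <- index_iota 1 (codelen m) | w4 m j == e %[mod 2]].

Section Codes.
Variables F L : finFieldType.

Definition genL (alpha : {unit L}) (e m : nat) : {poly L} :=
  \prod_(j <- Tset e m) ('X - (val alpha ^+ j)%:P).

Variable iota : {rmorphism F -> L}.

(* [genL] has its coefficients in the image of [iota] (lemma [map_genF]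
   below); [genF] is the same polynomial, with coefficients read in F. *)
Definition descend (x : L) : F := odflt 0 [pick k : F | iota k == x].

Definition genF (alpha : {unit L}) (e m : nat) : {poly F} :=
  map_poly descend (genL alpha e m).

(* The ideal generated by g in F[x]/(x^n - 1), each element being identified
   with the coefficient vector of its representative of degree < n.  For n = 0
   the modulus [{poly %/ _}] uses would be 'X; the codes below have n >= 3. *)
Definition cyclic_code (n : nat) (g : {poly F}) : {set 'rV[F]_n} :=
  [set poly_rV (val (q * in_qpoly ('X^n - 1) g))
     | q : {poly %/ ('X^n - 1 : {poly F})}].

Definition dual_code (n : nat) (C : {set 'rV[F]_n}) : {set 'rV[F]_n} :=
  [set x : 'rV[F]_n | [forall c in C, \sum_(i < n) x 0 i * c 0 i == 0]].

Definition LCD (n : nat) (C : {set 'rV[F]_n}) : Prop :=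
  C :&: dual_code C = [set 0].

Definition codeC (alpha : {unit L}) (e m : nat) : {set 'rV[F]_(codelen m)} :=
  cyclic_code (codelen m) (genF alpha e m).

End Codes.

Lemma w4_rot (k r d : nat) : (r < 4 ^ k)%N -> (d < 4)%N ->
  w4 k.+1 (4 * r + d) = w4 k.+1 (d * 4 ^ k + r).
Proof.
move=> lt_r lt_d; rewrite /w4 big_ord_recl big_ord_recr /= addnC.
have p4 i : (0 < 4 ^ i)%N by rewrite expn_gt0.
congr addn; last first.
  rewrite divnMDl // (divn_small lt_r) addn0 expn0 divn1.
  by rewrite mulnC modnMDl.
apply: eq_bigr => i _; rewrite /bump /= add1n expnS divnMA mulnC.
rewrite divnMDl // (divn_small lt_d) addn0.
have -> : (4 ^ k = 4 ^ (k - i.+1) * 4 * 4 ^ i)%N.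
  by rewrite -expnSr -expnD; congr expn; have := ltn_ord i; lia.
by rewrite mulnA divnMDl // mulnA modnMDl.
Qed.

Lemma w4_cycle (m j : nat) : (j < codelen m)%N ->
  w4 m ((4 * j) %% codelen m) = w4 m j.
Proof.
case: m => [|k]; rewrite /codelen //; rewrite expnS => ltj.
have p4 : (0 < 4 ^ k)%N by rewrite expn_gt0.
have lt_d : (j %/ 4 ^ k < 4)%N by rewrite ltn_divLR //; lia.
have lt_r : (j %% 4 ^ k < 4 ^ k)%N by rewrite ltn_mod.
have Ej := divn_eq j (4 ^ k).
set d := (j %/ 4 ^ k)%N in Ej lt_d *; set r := (j %% 4 ^ k)%N in Ej lt_r *.
have -> : ((4 * j) %% (4 * 4 ^ k - 1) = 4 * r + d)%N.
  have -> : (4 * j = d * (4 * 4 ^ k - 1) + (4 * r + d))%N by rewrite Ej; nia.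
  rewrite modnMDl modn_small //.
  case: (ltnP r (4 ^ k - 1)) => ?; first by lia.
  have : (d < 3)%N.
    rewrite ltnNge; apply/negP => ?; move: Ej.
    by have -> : d = 3%N; lia.
  by lia.
by rewrite (w4_rot lt_r lt_d) -Ej.
Qed.

Lemma perm_Tset (e m : nat) :
  perm_eq [seq ((4 * j) %% codelen m)%N | j <- Tset e m] (Tset e m).
Proof.
case: m => [|k] //; set m := k.+1.
have coT : coprime (codelen m) 4.
  rewrite /codelen expnS coprime_sym.
  have -> : (4 * 4 ^ k - 1 = (4 ^ k - 1) * 4 + 3)%N.
    have := expn_gt0 4 k; rewrite orTb; lia.
  by rewrite /coprime gcdnMDl.
have ltT j : j \in Tset e m -> (0 < j < codelen m)%N.
  by rewrite mem_filter mem_index_iota => /andP[].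
have uT : uniq (Tset e m) by rewrite filter_uniq // iota_uniq.
have sub x : x \in [seq ((4 * j) %% codelen m)%N | j <- Tset e m] ->
    x \in Tset e m.
  case/mapP=> j jT ->; have /andP[j0 jn] := ltT _ jT.
  move: jT; rewrite !mem_filter !mem_index_iota w4_cycle // => /andP[-> _] /=.
  rewrite ltn_mod (leq_trans _ jn) // andbT lt0n -/(dvdn _ _).
  by rewrite Gauss_dvdr // gtnNdvd.
have u4 : uniq [seq ((4 * j) %% codelen m)%N | j <- Tset e m].
  rewrite map_inj_in_uniq // => i j /ltT/andP[_ li] /ltT/andP[_ lj] /eqP.
  wlog le_ij : i j li lj / (i <= j)%N.
    by move=> W; case/orP: (leq_total i j) => ?; [exact: W|rewrite eq_sym => /W->].
  rewrite eq_sym eqn_mod_dvd ?leq_mul2l // -mulnBr Gauss_dvdr //.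
  case: (posnP (j - i)) => [? _|ji]; first by lia.
  by rewrite gtnNdvd //; lia.
by apply: uniq_perm => //; apply: (uniq_min_size u4 sub _).2; rewrite size_map.
Qed.

Lemma map_genF (F L : finFieldType) (iota : {rmorphism F -> L})
    (alpha : {unit L}) (e m : nat) :
  #|F| = 4%N -> #|L| = (4 ^ m)%N -> map_poly iota (genF iota alpha e m) =
  genL alpha e m.
Proof.
move=> cF cL.
have iotaK x : x ^+ 4 = x -> iota (descend iota x) = x.
  move=> x4; rewrite /descend; case: pickP => [k /eqP //|no].
  pose s := x :: [seq iota k | k <- enum F].
  have [us rs] : uniq s /\ all (root ('X^4 - 'X : {poly L})) s.
    split.
      rewrite /= map_inj_uniq ?enum_uniq ?andbT; last exact: fmorph_inj.
      by apply/mapP => -[k _ Ex]; move: (no k); rewrite Ex eqxx.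
    apply/allP => y; rewrite inE => /predU1P[->|/mapP[k _ ->]];
      rewrite rootE !hornerE ?x4 ?subrr //.
    by rewrite -rmorphXn -cF expf_card subrr.
  have szX : size ('X^4 - 'X : {poly L}) = 5.
    by rewrite size_polyDl size_polyXn // size_polyN size_polyX.
  have := max_poly_roots _ rs us.
  by rewrite szX /= size_map -cardE cF -size_poly_eq0 szX => /(_ isT).
have ch2 : 2 \in [pchar L].
  by apply: (@card_finPcharP L 2 (2 * m)) => //; rewrite cL expnM.
have an : val alpha ^+ codelen m = 1 :> L.
  apply: (mulfI (x := val alpha)); last first.
    rewrite -exprS mulr1 /codelen -[in LHS]subSn ?expn_gt0 // subn1 -cL.
    exact: expf_card.
  by rewrite -unitfE; case: (alpha).
pose fr : {rmorphism L -> L} := pFrobenius_aut ch2.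
have frE x : fr (fr x) = x ^+ 4 by rewrite /fr /= !pFrobenius_autE -exprM.
have inv : map_poly fr (map_poly fr (genL alpha e m)) = genL alpha e m.
  rewrite /genL -[RHS](perm_big _ (perm_Tset e m)) big_map /= !rmorph_prod.
  apply: eq_bigr => j _; rewrite !rmorphB /= !map_polyX !map_polyC /= frE.
  by rewrite expr_mod // -exprM mulnC.
apply/polyP => i; rewrite coef_map /genF coef_map_id0; last first.
  rewrite /descend; case: pickP => [k /= /eqP k0|//].
  by apply: (fmorph_inj iota); rewrite k0 rmorph0.
by apply: iotaK; rewrite -frE -{2}inv !coef_map.
Qed.

(* Main.v *)
(** For [i < 4 ^ m] the base-4 digits of [4 ^ m - 1 - i] are the complements to 3
    of those of [i], so the two 4-weights add up to [3 * m], which is even: the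
    set of zeros of the code is stable under [j |-> n - j].  Let [x] lie in the
    code and in its dual.  If [k] is in the defining set, [x] vanishes at
    [alpha ^+ k].  Otherwise [n - k] is not in it either, so the vector
    [(alpha ^+ (k * i))_i], whose polynomial vanishes at every n-th root of unity
    except [alpha ^+ (n - k)], is an L-combination of codewords; orthogonality to
    it says that [x] vanishes at [alpha ^+ k] again.  Having degree less than [n]
    and [n] roots, [x] is zero. *)

Require Import Defs.
From HB Require Import structures.
From mathcomp Require Import all_boot all_order all_algebra all_fingroup.
From mathcomp Require Import all_solvable all_field.
From mathcomp Require Import zify.

Set Implicit Arguments.
Unset Strict Implicit.
Unset Printing Implicit Defensive.

Import GRing.Theory.
Local Open Scope ring_scope.

Lemma w4_compl (m i : nat) : (i < 4 ^ m)%N ->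
  (w4 m (4 ^ m - 1 - i) + w4 m i = 3 * m)%N.
Proof.
have w4S k j : w4 k.+1 j = (j %% 4 + w4 k (j %/ 4))%N.
  rewrite /w4 big_ord_recl /= expn0 divn1; congr addn.
  by apply: eq_bigr => l _; rewrite /bump add1n expnS divnMA.
elim: m i => [|m IHm] i lt_i; first by rewrite /w4 !big_ord0.
have lt_q : (i %/ 4 < 4 ^ m)%N by rewrite ltn_divLR // mulnC -expnS.
rewrite !w4S; have := IHm _ lt_q.
(* No borrow occurs: every digit of [4 ^ m.+1 - 1] is 3. *)
have -> : ((4 ^ m.+1 - 1 - i) %/ 4 = 4 ^ m - 1 - i %/ 4)%N.
  by rewrite expnS; lia.
have -> : ((4 ^ m.+1 - 1 - i) %% 4 = 3 - i %% 4)%N by rewrite expnS; lia.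
by lia.
Qed.

Lemma mem_Tset_opp (e m j : nat) : ~~ odd m -> (0 < j < codelen m)%N ->
  (codelen m - j \in Tset e m)%N = (j \in Tset e m).
Proof.
rewrite /codelen => ev_m /andP[j0 ltj]; rewrite !mem_filter !mem_index_iota.
have -> : (0 < 4 ^ m - 1 - j < codelen m)%N by rewrite /codelen; lia.
rewrite /codelen j0 ltj !andbT.
have := @w4_compl m j; move: ev_m => /[swap] /(_ ltac:(lia)).
by lia.
Qed.

(** As [g] divides ['X^n - 1], reduction modulo ['X^n - 1] preserves divisibility by [g]; conversely
    [rVpoly c] has degree less than [n], so it is its own residue. *)
Lemma mem_cyclic_code (F : finFieldType) (n : nat) (g : {poly F})
    (c : 'rV[F]_n) :
  (0 < n)%N -> g %| 'X^n - 1 -> (c \in cyclic_code n g) = (g %| rVpoly c).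
Proof.
move=> n0 g_dvd; have szh : size ('X^n - 1 : {poly F}) = n.+1.
  exact: size_XnsubC.
have mon_h : 'X^n - 1 \is @monic F by exact: monicXnsubC.
(* For [0 < n] the modulus is monic and nonconstant, so the default ['X] is avoided. *)
have mkE : mk_monic ('X^n - 1 : {poly F}) = 'X^n - 1.
  by rewrite /mk_monic szh ltnS n0 mon_h.
apply/imsetP/idP => [[q _ ->]|/dvdpP[u cE]].
  rewrite poly_rV_K; last first.
    by rewrite -ltnS; apply: leq_trans (size_mk_monic _) _; rewrite mkE szh.
  rewrite [val _]poly_of_qpolyM; case: q => q _ /=.
  by rewrite mkE -!Pdiv.IdomainMonic.modpE // -dvdp_mod // dvdp_mull // -dvdp_mod.
exists (in_qpoly ('X^n - 1) u) => //.
rewrite -in_qpolyM -cE [val _]in_qpoly_small ?rVpolyK //.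
by rewrite mkE szh ltnS size_poly.
Qed.

Lemma horner_map_rVpoly (F L : fieldType) (iota : {rmorphism F -> L}) (n : nat)
    (c : 'rV[F]_n) (y : L) :
  (map_poly iota (rVpoly c)).[y] = \sum_(i < n) iota (c 0 i) * y ^+ i.
Proof.
rewrite (@horner_coef_wide _ n) ?size_map_poly ?size_poly //.
by apply: eq_bigr => i _; rewrite coef_map coef_rVpoly_ord.
Qed.

(** Writing [d] as [u] times the image of [g] makes it an L-combination of images of the shifts
    [g * 'X^s], which are codewords over F; orthogonality then extends by linearity. *)
Lemma dual_cyclic_code_orth (F L : finFieldType) (iota : {rmorphism F -> L})
    (n : nat) (g : {poly F}) (x : 'rV[F]_n) (d : {poly L}) :
  (0 < n)%N -> g %| 'X^n - 1 -> x \in dual_code (cyclic_code n g) ->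
  (size d <= n)%N -> map_poly iota g %| d ->
  \sum_(i < n) iota (x 0 i) * d`_i = 0.
Proof.
move=> n0 g_dvd; rewrite inE => /forall_inP x_dual sz_d /dvdpP[u dE].
have [d0|d0] := eqVneq d 0.
  by rewrite d0 big1 // => i _; rewrite coef0 mulr0.
have [u0 g0] : u != 0 /\ map_poly iota g != 0.
  by apply/andP; rewrite -negb_or -mulf_eq0 -dE.
have E (i : 'I_n) :
    d`_i = \sum_(s < size u) u`_s * iota (g * 'X^s)`_i.
  rewrite dE -[u in LHS]coefK poly_def mulr_suml coef_sum; apply: eq_bigr => s _.
  rewrite -scalerAl coefZ -coef_map rmorphM /= map_polyXn.
  by rewrite [_ * map_poly _ _]mulrC.
under eq_bigr do rewrite E mulr_sumr.
rewrite exchange_big big1 // => s _.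
under eq_bigr do rewrite mulrCA -rmorphM.
rewrite -mulr_sumr -rmorph_sum.
have gF0 : g != 0 by rewrite -(map_poly_eq0 iota).
(* Since [s < size u], the shift is no longer than [d] and does not wrap around. *)
have sz_gs : (size (g * 'X^s)%R <= n)%N.
  rewrite size_mulXn //; apply: leq_trans sz_d.
  rewrite dE size_mul // size_map_poly.
  move: gF0; rewrite -size_poly_gt0; case: (size g) => // k _.
  by rewrite !addnS ltn_add2r.
have gs_in : poly_rV (g * 'X^s) \in cyclic_code n g.
  by rewrite mem_cyclic_code // poly_rV_K // dvdp_mulr.
have /eqP := x_dual _ gs_in; under eq_bigr do rewrite mxE.
by move=> ->; rewrite rmorph0 mulr0.
Qed.

(** The general criterion: a cyclic code with simple zeros, stable under inversion, is LCD. *)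
Lemma LCD_cyclic_code (F L : finFieldType) (iota : {rmorphism F -> L})
    (n : nat) (b : L) (T : seq nat) (g : {poly F}) :
  n.-primitive_root b -> uniq T -> {in T, forall j, 0 < j < n}%N ->
  {in T, forall j, n - j \in T}%N ->
  map_poly iota g = \prod_(j <- T) ('X - (b ^+ j)%:P) ->
  LCD (cyclic_code n g).
Proof.
move=> prim_b uT ltT oppT gE.
have n0 := prim_order_gt0 prim_b.
have inj_b (s : seq nat) : uniq s -> {in s, forall j, j < n}%N ->
    uniq [seq b ^+ j | j <- s].
  move=> us lts; rewrite map_inj_in_uniq // => i j /lts lti /lts ltj /eqP.
  by rewrite (eq_prim_root_expr prim_b) !modn_small // => /eqP.
have uTb : uniq [seq b ^+ j | j <- T] by apply: inj_b => // j /ltT /andP[].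
rewrite -(big_map (fun j => b ^+ j) xpredT (fun z => 'X - z%:P)) in gE.
have dvd_g (p : {poly L}) :
    {in T, forall j, root p (b ^+ j)} -> map_poly iota g %| p.
  move=> rp; rewrite gE; apply: uniq_roots_dvdp; last by rewrite uniq_rootsE.
  by apply/allP => _ /mapP[j jT ->]; exact: rp.
have g_dvd : g %| 'X^n - 1.
  rewrite -(dvdp_map iota) rmorphB rmorph1 /= map_polyXn; apply: dvd_g => j _.
  by rewrite rootE !hornerE exprAC (prim_expr_order prim_b) expr1n subrr.
apply/setP => x; rewrite in_set1; apply/setIP/eqP => [[xC xD]|->]; last first.
  rewrite mem_cyclic_code // linear0 dvdp0 inE; split=> //.
  by apply/forall_inP => c _; rewrite big1 // => i _; rewrite mxE mul0r.
suff x0 : map_poly iota (rVpoly x) = 0.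
  by apply: (can_inj (@rVpolyK _ _)); apply/eqP;
     rewrite linear0 -(map_poly_eq0 iota) x0.
apply: (@roots_geq_poly_eq0 _ _ [seq b ^+ k | k <- index_iota 0 n]).
- apply/allP => _ /mapP[k + ->]; rewrite mem_index_iota rootE => /= ltk.
  have [kT|kT] := boolP (k \in T).
    move: xC; rewrite mem_cyclic_code // -(dvdp_map iota) => /dvdpP[u ->].
    by rewrite -rootE rootM gE root_prod_XsubC map_f ?orbT.
  pose d := \poly_(i < n) (b ^+ k) ^+ i.
  have d_dvd : map_poly iota g %| d.
    apply: dvd_g => j jT; have /andP[j0 ltj] := ltT _ jT.
    rewrite rootE horner_poly; under eq_bigr do rewrite -exprMn -exprD.
    (* The value at [b ^+ j] is a geometric sum of ratio [b ^+ (k + j)], zero unless the ratio is 1.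
       As [0 < k + j < 2 * n], ratio 1 would force [k = n - j], an element of [T]. *)
    have nz : b ^+ (k + j) - 1 != 0.
      rewrite subr_eq0 -(prim_order_dvd prim_b); apply: contra kT => dvd_kj.
      suff -> : k = (n - j)%N by exact: oppT.
      by have /dvdnP[[|[|q]]] := dvd_kj; lia.
    rewrite -(mulrI_eq0 _ (mulfI nz)) -subrX1 exprAC (prim_expr_order prim_b).
    by rewrite expr1n subrr.
  rewrite horner_map_rVpoly.
  have := dual_cyclic_code_orth n0 g_dvd xD (size_poly _ _) d_dvd.
  by under eq_bigr do rewrite coef_poly ltn_ord; move/eqP.
- by apply: inj_b => [|k]; rewrite ?iota_uniq // mem_index_iota.
by rewrite size_map size_iota subn0 size_map_poly size_poly.
Qed.

Theorem theorem6p3 (m : nat) (F L : finFieldType) (iota : {rmorphism F -> L})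
  (alpha : {unit L}) (hm : (1 <= m)%N) (hev : ~~ odd m)
  (hF : #|F| = 4%N) (hL : #|L| = (4 ^ m)%N)
  (halpha : generator [set: {unit L}] alpha) :
  LCD (codeC iota alpha 0 m) /\ LCD (codeC iota alpha 1 m).
Proof.
have ord_alpha : #[alpha]%g = codelen m.
  by rewrite /order -(eqP halpha) card_finField_unit hL /codelen subn1.
have n0 : (0 < codelen m)%N by rewrite -ord_alpha order_gt0.
have prim_alpha : (codelen m).-primitive_root (val alpha).
  rewrite /primitive_root_of_unity n0.
  (* The exponents tested are [i.+1] for [i < n], that is 1 to [n]; only [n] itself is a multiple of
     the order. *)
  apply/forallP => i; rewrite unity_rootE -FinRing.val_unitX -FinRing.val_unit1.
  rewrite (inj_eq val_inj) -order_dvdn ord_alpha; apply/eqP.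
  have := ltn_ord i; rewrite leq_eqVlt => /predU1P[->|lti].
    by rewrite dvdnn eqxx.
  by rewrite gtnNdvd //; lia.
have LCDe e : LCD (codeC iota alpha e m).
  have ltT : {in Tset e m, forall j, 0 < j < codelen m}%N.
    by move=> j; rewrite mem_filter mem_index_iota => /andP[].
  apply: (@LCD_cyclic_code _ _ iota _ (val alpha) (Tset e m)) => //.
  - by rewrite filter_uniq // iota_uniq.
  - by move=> j jT; rewrite mem_Tset_opp // ltT.
  exact: map_genF.
by split.
Qed.
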